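(* Let $\{(X_n,Y_n)\}_{n=1}^{\infty}$ be a sequence of random vectors in $\mathbb{R}^2$ which converges weakly (in distribution) to some random vector $(X,Y)$ in $\mathbb{R}^2$. If $$\sup_{1\le n<\infty} E[X_n^2] < \infty,$$ then $$\mathrm{var}\, E[X\mid X+Y] \le \liminf_{n\to\infty}\, \mathrm{var}\, E[X_n\mid X_n+Y_n].$$
   Context: $E[X\mid X+Y]$ denotes the conditional expectation of $X$ given $\sigma(X+Y)$, and similarly for $E[X_n\mid X_n+Y_n]$. No independence between $X_n$ and $Y_n$ (or between $X$ and $Y$) is assumed. The vectors $(X_n,Y_n)$ and $(X,Y)$ may be defined on different probability spaces. *)

(* Defs.v *)
From HB Require Import structures.
From mathcomp Require Export all_boot all_order all_algebra.
From mathcomp Require Export all_classical all_reals all_analysis.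

Set Implicit Arguments.
Unset Strict Implicit.
Unset Printing Implicit Defensive.

Import Order.TTheory GRing.Theory Num.Theory.
Import numFieldNormedType.Exports.

Local Open Scope classical_set_scope.
Local Open Scope ring_scope.
Local Open Scope ereal_scope.

(* [W] is a version of E[X | sigma(Z)]. Versions are unique only up to
   P-almost sure equality, hence a predicate rather than a function.
   The type [g_sigma_algebra_preimageType Z] is [T] equipped with sigma(Z), so
   the first clause says that [W] is sigma(Z)-measurable. *)
Definition is_cond_expectation {d : measure_display} {T : measurableType d}
    {R : realType} (P : probability T R) (X Z W : T -> R) : Prop :=
  [/\ measurable_fun [set: g_sigma_algebra_preimageType Z]
        (W : g_sigma_algebra_preimageType Z -> R),
      P.-integrable [set: T] (EFin \o W)
    & forall A : set T, g_sigma_algebra_preimage Z A ->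
        \int[P]_(w in A) (W w)%:E = \int[P]_(w in A) (X w)%:E].

(* Each [Vn n] may live on its own probability space. *)
Definition cvg_in_distribution2 {R : realType}
    {dn : nat -> measure_display} {Tn : forall n, measurableType (dn n)}
    (Pn : forall n, probability (Tn n) R) (Vn : forall n, Tn n -> R * R)
    {d : measure_display} {T : measurableType d}
    (P : probability T R) (V : T -> R * R) : Prop :=
  forall f : R * R -> R, continuous f -> bounded_fun f ->
    'E_(Pn n)[f \o Vn n] @[n --> \oo] --> 'E_P[f \o V].

(* Main.v *)
Require Import Defs.
From mathcomp Require Import all_boot all_order all_algebra.
From mathcomp Require Import all_classical all_reals all_analysis.
From mathcomp Require Import measurable_realfun ring lra.

(** Write Z = X + Y, V = W - E[W], and similarly Z_n, V_n.  The variance of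
    W = E[X | Z] is a supremum of quantities that pass to weak limits.

    For bounded continuous g, integrating 2 V g(Z) - g(Z)^2 <= V^2 gives
      J(g) := 2 E[V g(Z)] - E[g(Z)^2] <= var W            ([variance_ge]),
    and since g(Z) is sigma(Z)-measurable, W may be replaced by X inside J:
      J(g) = 2 (E[X g(Z)] - E[X] E[g(Z)]) - E[g(Z)^2]
    ([cond_expectation_centered]).  In this form J only involves the joint law
    of (X, Y), and each of its terms is a limit of the corresponding term for
    (X_n, Y_n).  The integrands without the factor X are bounded and
    continuous; for the others, the bound on E[X_n^2] makes the error of
    truncating X_n at level K at most a constant over K, uniformly in n
    ([truncation_error], [cvg_Rintegral_mul]).  Hence
      J(g) <= liminf_n var W_n                 ([variational_le_limn_einf]).

    It remains to see that the supremum of J(g) over bounded continuous g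
    reaches var W.  As W is not known beforehand to be square integrable, let
    G be V truncated at level k.  Then E[G^2] <= 2 E[V G] - E[G^2], and G,
    being bounded and sigma(Z)-measurable, can be replaced by some g(Z) with g
    continuous and bounded at an arbitrarily small cost, measured in L^1 with
    the integrable weight 2 |V| + 2 k ([continuous_dense]).  So
    E[G^2] <= liminf_n var W_n for every k, and monotone convergence in k
    concludes ([integral_sqr_clip_le]).

    The density of the g(Z) and the passage from W to X are both instances of
    a functional monotone class argument: [bounded_measurable_ind] reduces a
    property of bounded measurable functions to indicators, and
    [sigma_fun_ind] reduces it, for the sigma-algebra generated by Z, to the
    functions g(Z). *)

Set Implicit Arguments.
Unset Strict Implicit.
Unset Printing Implicit Defensive.

Import Order.TTheory GRing.Theory Num.Theory.
Import numFieldNormedType.Exports.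
Import HBSimple HBNNSimple.
Local Open Scope classical_set_scope.
Local Open Scope ring_scope.
Local Open Scope ereal_scope.

(** * Truncation *)

Definition clip (R : realType) (K x : R) : R := Num.max (- K)%R (Num.min K x).
Arguments clip {R} K x.

Lemma clip_cases (R : realType) (K x : R) : (0 <= K)%R ->
  [\/ clip K x = x /\ (- K <= x <= K)%R,
      clip K x = K /\ (K <= x)%R |
      clip K x = (- K)%R /\ (x <= - K)%R].
Proof.
move=> K0; rewrite /clip; have [Kx|xK] := leP K x.
  by rewrite max_r; [apply: Or32 | lra].
have [|Kx] := leP (- K)%R x; last by apply: Or33; split => //; exact: ltW.
by move=> Kx; apply: Or31; split => //; apply/andP; split => //; exact: ltW.
Qed.

Lemma normr_clip_le (R : realType) (K x : R) : (0 <= K -> `|clip K x| <= K)%R.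
Proof.
by move=> K0; rewrite ler_norml; case: (clip_cases x K0) => -[-> ?]; lra.
Qed.

Lemma clip_id (R : realType) (K x : R) : (`|x| <= K -> clip K x = x)%R.
Proof.
move=> xK; have K0 : (0 <= K)%R := le_trans (normr_ge0 x) xK.
by move: xK; rewrite ler_norml; case: (clip_cases x K0) => -[-> ?]; lra.
Qed.

Lemma dist_clip_le (R : realType) (K x y : R) :
  (0 <= K -> `|clip K x - clip K y| <= `|x - y|)%R.
Proof.
move=> K0; rewrite ler_norml.
have := lexx `|x - y|%R; rewrite {1}ler_norml.
by case: (clip_cases x K0) => -[-> ?]; case: (clip_cases y K0) => -[-> ?]; lra.
Qed.

(** For x = V and G = clip K V, this yields E[G^2] <= 2 E[V G] - E[G^2]. *)
Lemma clip_sqr_le (R : realType) (K x : R) :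
  (0 <= K -> clip K x ^+ 2 <= x * clip K x)%R.
Proof. by move=> K0; case: (clip_cases x K0) => -[-> ?]; nra. Qed.

(** A second moment controls the truncation error, since |x| >= K wherever the
    error does not vanish. *)
Lemma dist_clip_tail (R : realType) (K x : R) :
  (0 <= K -> `|x - clip K x| * K <= x ^+ 2)%R.
Proof.
move=> K0; rewrite -{2}(ger0_norm K0) -normrM ler_norml.
by case: (clip_cases x K0) => -[-> ?]; nra.
Qed.

Lemma clip_sqr_mono (R : realType) (K L x : R) :
  (0 <= K -> K <= L -> clip K x ^+ 2 <= clip L x ^+ 2)%R.
Proof.
move=> K0 KL; have L0 := le_trans K0 KL.
by case: (clip_cases x K0) => -[-> ?]; case: (clip_cases x L0) => -[-> ?]; nra.
Qed.

Lemma sqr_clip_le (R : realType) (K x : R) :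
  (0 <= K -> clip K x ^+ 2 <= x ^+ 2)%R.
Proof. by move=> K0; case: (clip_cases x K0) => -[-> ?]; nra. Qed.

Lemma continuous_clip (R : realType) (K : R) : continuous (clip K).
Proof.
move=> x; apply: (@continuous_max R R (cst (- K)%R) (fun y => Num.min K y) x).
  exact: cvg_cst.
by apply: (@continuous_min R R (cst K) id x); [exact: cvg_cst|exact: cvg_id].
Qed.

(** * Monotone classes of bounded functions *)

Definition bounded_limit_closed (R : realType) (T : Type)
    (Q : (T -> R) -> Prop) : Prop :=
  (forall (a : R) f g, Q f -> Q g -> Q (fun x => a * f x + g x)%R) /\
  (forall (f_ : nat -> T -> R) (f : T -> R) (K : R), (forall n, Q (f_ n)) ->
     (forall n x, `|f_ n x| <= K)%R -> (forall x, f_ n x @[n --> \oo] --> f x) ->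
     Q f).

(** Bounded measurable functions are bounded pointwise limits of linear
    combinations of indicators. *)
Lemma bounded_measurable_ind (R : realType) (d : measure_display)
    (T : measurableType d) (Q : (T -> R) -> Prop) :
  bounded_limit_closed Q ->
  (forall A, measurable A -> Q \1_A) ->
  forall (f : T -> R) (K : R), measurable_fun setT f ->
    (forall x, `|f x| <= K)%R -> Q f.
Proof.
move=> [QD Qlim] Q1 f K mf fK.
have Q0 : Q (cst 0%R).
  have := QD (-1)%R _ _ (Q1 _ measurableT) (Q1 _ measurableT).
  by congr Q; apply/funext => x /=; lra.
have QS (h : {sfun T >-> R}) : Q h.
  suff H (s : seq R) : Q (fun x => \sum_(y <- s) (y * \1_(h @^-1` [set y]) x))%R.
    have := H (finmap.enum_fset (fset_set (range h))).
    by congr Q; apply/funext => x; rewrite fimfunE fsbig_finite.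
  elim: s => [|y s IH].
    by move: Q0; congr Q; apply/funext => x; rewrite big_nil.
  have mA : measurable (h @^-1` [set y]).
    by rewrite -[X in measurable X]setTI; exact: measurable_funP.
  have := QD y _ _ (Q1 _ mA) IH.
  by congr Q; apply/funext => x; rewrite big_cons.
(* adding the bound K makes f nonnegative, as the approximation from below by
   simple functions requires *)
pose g := EFin \o (fun x => f x + K)%R.
have mg : measurable_fun setT g.
  by apply/measurable_EFinP; exact: measurable_funD.
have g0 x : setT x -> 0 <= g x.
  move=> _; rewrite /g lee_fin; have := fK x; rewrite ler_norml => /andP[? _].
  lra.
have Qg : Q (fun x => f x + K)%R.
  apply: (Qlim (fun n => nnsfun_approx measurableT mg n) _ (K + K)%R).
  - by move=> n; exact: QS.
  - move=> n x; rewrite ger0_norm//.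
    have := le_approx n g0 (I : setT x).
    rewrite -nnsfun_approxE lee_fin => /le_trans; apply.
    by rewrite lerD2r (le_trans _ (fK x))// ler_norm.
  - move=> x; have /fine_cvg := cvg_nnsfun_approx measurableT mg g0 (I : setT x).
    exact.
have := QD (- K)%R _ _ (Q1 _ measurableT) Qg.
by congr Q; apply/funext => x; rewrite indicT /=; lra.
Qed.

(** Open rays generate the Borel sets, and their indicators are bounded limits of
    continuous functions. *)
Lemma cvg_indic_ray (R : realType) (a z : R) :
  clip 1 (n%:R * Num.max 0 (z - a))%R @[n --> \oo] --> (\1_(`]a, +oo[) z : R).
Proof.
have [za|az] := leP (z - a)%R 0%R.
  rewrite (_ : (\1_(_) z)%R = 0%R); last first.
    by rewrite indicE memNset//= in_itv/= andbT; apply/negP; rewrite -leNgt; lra.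
  under eq_fun do rewrite mulr0 clip_id ?normr0//.
  exact: cvg_cst.
rewrite (_ : (\1_(_) z)%R = 1%R); last first.
  by rewrite indicE mem_set//= in_itv/= andbT; lra.
apply: cvg_near_cst; near=> n.
have n1 : (1 <= n%:R * (z - a))%R.
  rewrite -ler_pdivrMr//; near: n.
  exact: nbhs_infty_ger.
by case: (clip_cases (n%:R * (z - a))%R ler01) => -[-> ?]; lra.
Unshelve. all: by end_near. Qed.

Lemma cvg_sum_indic (R : realType) (T : Type) (F : nat -> set T) (x : T) :
  trivIset setT F ->
  (\sum_(i < n) \1_(F i) x)%R @[n --> \oo] --> (\1_(\bigcup_i F i) x : R).
Proof.
move=> tF; have [[k _ Fkx]|nF] := pselect ((\bigcup_i F i) x); last first.
  rewrite indicE memNset//.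
  apply: cvg_near_cst; apply: nearW => n; rewrite big1// => i _.
  by rewrite indicE memNset// => Fix; apply: nF; exists i.
rewrite indicE mem_set; last by exists k.
apply: cvg_near_cst; near=> n.
have kn : (k < n)%N by near: n; exists k.+1.
rewrite (bigD1 (Ordinal kn))//= indicE mem_set// big1 ?addr0// => i ik.
rewrite indicE memNset// => Fix; move/eqP: ik; apply; apply/val_inj => /=.
by apply: tF => //; exists x.
Unshelve. all: by end_near. Qed.

(** The preimages under Z of the rays form a pi-system generating sigma(Z), so
    the Dynkin lemma gives the indicators of all sets of sigma(Z); bounded
    functions follow by [bounded_measurable_ind]. *)
Lemma sigma_fun_ind (R : realType) (d : measure_display) (T : measurableType d)
    (Z : T -> R) (Q : (T -> R) -> Prop) :
  bounded_limit_closed Q ->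
  (forall (g : R -> R) (K : R), continuous g -> (forall z, `|g z| <= K)%R ->
     Q (g \o Z)) ->
  forall (F : T -> R) (K : R),
    measurable_fun [set: g_sigma_algebra_preimageType Z]
      (F : g_sigma_algebra_preimageType Z -> R) ->
    (forall x, `|F x| <= K)%R -> Q F.
Proof.
move=> Qclosed Qg; have [QD Qlim] := Qclosed.
have Qcst c : Q (cst c).
  by apply: (Qg (cst c) `|c|%R) => // z; exact: cvg_cst.
have QB B : measurable B -> Q \1_(Z @^-1` B).
  have mE : (measurable : set (set R)) = <<s @RGenOInfty.G R >>.
    exact: RGenOInfty.measurableE.
  rewrite mE => mB.
  apply: (@dynkin_induction _ _ (@RGenOInfty.G R) (fun B => Q \1_(Z @^-1` B)))
    mB => //.
  - move=> _ _ [a ->] [b ->]; exists (Num.max a b).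
    apply/seteqP; split => z /=; rewrite !in_itv/= !andbT gt_max.
      by move=> [-> ->].
    by move=> /andP[].
  - by rewrite preimage_setT; move: (Qcst 1%R); congr Q; apply/funext => x;
      rewrite indicT.
  - move=> _ [a ->].
    apply: (Qlim (fun n => (fun z => clip 1 (n%:R * Num.max 0 (z - a))%R) \o Z)
      _ 1%R).
    + move=> n; apply: (Qg _ 1%R); last by move=> z; exact: normr_clip_le.
      move=> z.
      apply: (@continuous_comp R R R (fun z => n%:R * Num.max 0 (z - a))%R
        (clip 1%R) z); last exact: continuous_clip.
      apply: cvgM; first exact: cvg_cst.
      apply: (@continuous_max R R (cst 0%R) (fun y => y - a)%R z).
        exact: cvg_cst.
      by apply: cvgB; [exact: cvg_id|exact: cvg_cst].
    + by move=> n x; exact: normr_clip_le.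
    + by move=> x; exact: cvg_indic_ray.
  - move=> S _ QS; have := QD (-1)%R _ _ QS (Qcst 1%R).
    congr Q; apply/funext => x; rewrite preimage_setC !indicE/= in_setC.
    by case: (_ \in _) => /=; lra.
  - move=> F _ tF QF.
    apply: (Qlim (fun n x => \sum_(i < n) \1_(Z @^-1` F i) x)%R _ 1%R).
    + elim=> [|n IH].
        by move: (Qcst 0%R); congr Q; apply/funext => x; rewrite big_ord0.
      have := QD 1%R _ _ (QF n) IH.
      by congr Q; apply/funext => x; rewrite big_ord_recr/= mul1r addrC.
    + move=> n x; rewrite ger0_norm; last by apply: sumr_ge0 => i _.
      have [[i Fi]|nF] := pselect (exists i : 'I_n, F i (Z x)).
        rewrite (bigD1 i)//= indicE mem_set// big1 ?addr0// => j ji.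
        rewrite indicE memNset// => Fj; move/eqP: ji; apply; apply/val_inj => /=.
        by apply: tF => //; exists (Z x).
      rewrite big1// => i _; rewrite indicE memNset// => Fi.
      by apply: nF; exists i.
    + move=> x; rewrite preimage_bigcup.
      by apply: cvg_sum_indic => i j _ _ [y [Fi Fj]]; apply: tF => //; exists (Z y).
move=> F K.
apply: (@bounded_measurable_ind R _ (g_sigma_algebra_preimageType Z) Q Qclosed).
by move=> A [B mB <-]; rewrite setTI; exact: QB.
Qed.

(** * Integrals against bounded functions *)

Lemma normr_lim_le (R : realType) (u : nat -> R) (l K : R) :
  u n @[n --> \oo] --> l -> (forall n, `|u n| <= K)%R -> (`|l| <= K)%R.
Proof.
move=> /cvg_norm ul uK; rewrite -(cvg_lim (@Rhausdorff R) ul).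
by apply: limr_le; [apply/cvg_ex; exists `|l|%R|exact: nearW].
Qed.

Section bounded_integrals.
Context (R : realType) (d : measure_display) (T : measurableType d).
Context (P : probability T R).
Implicit Types (f g U F Z X W G : T -> R) (K : R).

Lemma integrable_bounded g K :
  measurable_fun setT g -> (forall x, `|g x| <= K)%R ->
  P.-integrable setT (EFin \o g).
Proof.
move=> mg gK; apply: measurable_bounded_integrable => //.
  by rewrite ltey_eq fin_num_measure.
exists K; split; first exact: num_real.
by move=> M KM x _; exact: le_trans (gK x) (ltW KM).
Qed.

Lemma integrable_mul_bounded U g K :
  P.-integrable setT (EFin \o U) -> measurable_fun setT g ->
  (forall x, `|g x| <= K)%R ->
  P.-integrable setT (EFin \o (fun x => U x * g x)%R).
Proof.
move=> iU mg gK; apply: (integrableMl _ iU mg) => //.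
exists K; split; first exact: num_real.
by move=> M KM x _; exact: le_trans (gK x) (ltW KM).
Qed.

Lemma cvg_integral_bounded U (f_ : nat -> T -> R) f K :
  P.-integrable setT (EFin \o U) -> (forall n, measurable_fun setT (f_ n)) ->
  (forall n x, `|f_ n x| <= K)%R -> (forall x, f_ n x @[n --> \oo] --> f x) ->
  (\int[P]_x (U x * f_ n x) @[n --> \oo] --> (\int[P]_x (U x * f x)))%R.
Proof.
move=> iU mf fK ff.
have mU : measurable_fun setT U by apply/measurable_EFinP/(measurable_int P).
have Uf_f x : (U x * f_ n x @[n --> \oo] --> U x * f x)%R.
  by apply: cvgM; [exact: cvg_cst|exact: ff].
have mUf n : measurable_fun setT (fun x => (U x * f_ n x)%:E).
  by apply/measurable_EFinP; exact: measurable_funM.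
have UfE x : (setT x -> (U x * f_ n x)%:E @[n --> \oo] --> (U x * f x)%:E).
  by move=> _; apply: cvg_EFin; [exact: nearW|exact: Uf_f].
have iUK : P.-integrable setT (EFin \o (fun x => `|U x| * K)%R).
  apply: (@integrable_mul_bounded (fun x => `|U x|)%R (cst K) `|K|%R) => //.
  exact: integrable_norm.
have UfK n x : setT x -> `|(U x * f_ n x)%:E| <= (`|U x| * K)%:E.
  by move=> _; rewrite lee_fin normrM ler_wpM2l.
have fn x : setT x -> (`|U x| * K)%:E \is a fin_num by [].
have iUf : P.-integrable setT (EFin \o (fun x => U x * f x)%R).
  apply: (@integrable_mul_bounded U f K) => //.
    by apply: measurable_fun_cvg mf _ => x _; exact: ff.
  by move=> x; exact: normr_lim_le (ff x) _.
rewrite /Rintegral; apply: fine_cvg; rewrite fineK; last exact: integrable_fin_num.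
exact: (dominated_cvg measurableT mUf UfE fn iUK UfK).
Qed.

Lemma measurable_continuous_comp (g : R -> R) Z : continuous g ->
  measurable_fun setT Z -> measurable_fun setT (fun x => g (Z x)).
Proof.
by move=> cg mZ; apply: (measurableT_comp (continuous_measurable_fun cg) mZ).
Qed.

Lemma integrable_bounded_sqr f K : measurable_fun setT f ->
  (forall x, `|f x| <= K)%R -> P.-integrable setT (EFin \o (fun x => f x ^+ 2)%R).
Proof.
move=> mf fK; apply: (@integrable_bounded _ (K ^+ 2)%R).
  exact: measurable_funX.
by move=> x; rewrite normrX lerXn2r ?nnegrE// (le_trans _ (fK x)).
Qed.

Lemma sigma_measurable_fun Z F : measurable_fun setT Z ->
  measurable_fun [set: g_sigma_algebra_preimageType Z]
    (F : g_sigma_algebra_preimageType Z -> R) ->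
  measurable_fun setT F.
Proof.
move=> mZ mF _ B mB; have [C mC <-] := mF measurableT B mB.
exact: mZ.
Qed.

(** The defining property of a conditional expectation, stated for sets, extends
    to bounded test functions by the monotone class argument. *)
Lemma cond_expectation_bounded X W Z G K :
  measurable_fun setT Z -> P.-integrable setT (EFin \o X) ->
  is_cond_expectation P X Z W ->
  measurable_fun [set: g_sigma_algebra_preimageType Z]
    (G : g_sigma_algebra_preimageType Z -> R) ->
  (forall x, `|G x| <= K)%R ->
  (\int[P]_x (W x * G x) = \int[P]_x (X x * G x))%R.
Proof.
move=> mZ iX [mW iW WX] mG GK.
pose Q F := [/\ measurable_fun setT F, exists K, forall x, (`|F x| <= K)%R &
  (\int[P]_x (W x * F x) = \int[P]_x (X x * F x))%R].
have Qclosed : bounded_limit_closed Q.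
  split.
  + move=> a f g [mf [Kf fK] Qf] [mg [Kg gK] Qg]; split.
    * by apply: measurable_funD => //; exact: measurable_funM.
    * exists (`|a| * Kf + Kg)%R => x; rewrite (le_trans (ler_normD _ _))//.
      by rewrite lerD// normrM ler_wpM2l.
    * have H V : P.-integrable setT (EFin \o V) ->
          (\int[P]_x (V x * (a * f x + g x)) =
          a * \int[P]_x (V x * f x) + \int[P]_x (V x * g x))%R.
        move=> iV; have iVf := integrable_mul_bounded iV mf fK.
        have iVg := integrable_mul_bounded iV mg gK.
        rewrite -RintegralZl// -RintegralD//.
          by apply: eq_Rintegral => x _; ring.
        exact: (@integrableZl _ _ _ _ _ measurableT a _ iVf).
      by rewrite !H// Qf Qg.
  + move=> f_ f M Qf fM ff.
    have mf n : measurable_fun setT (f_ n) by case: (Qf n).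
    split.
    * by apply: measurable_fun_cvg mf _ => x _; exact: ff.
    * by exists M => x; exact: normr_lim_le (ff x) _.
    * have cW := cvg_integral_bounded iW mf fM ff.
      have cX := cvg_integral_bounded iX mf fM ff.
      have WXf : (fun n => \int[P]_x (W x * f_ n x))%R =
          (fun n => \int[P]_x (X x * f_ n x))%R.
        by apply/funext => n; case: (Qf n).
      by rewrite WXf in cW; exact: (cvg_unique _ cW cX).
have QA (A : set T) : g_sigma_algebra_preimage Z A -> Q \1_A.
  move=> ZA; have mA : measurable A by case: ZA => B mB <-; exact: mZ.
  split; first exact: measurable_indic.
    by exists 1%R => x; rewrite indicE; case: (_ \in _); rewrite ?normr1 ?normr0.
  have H V : (\int[P]_x (V x * \1_A x) = fine (\int[P]_(x in A) (V x)%:E)%E)%R.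
    rewrite -[RHS]/(Rintegral P A V) [RHS]Rintegral_mkcond.
    apply: eq_Rintegral => x _; rewrite indicE patchE.
    by case: (_ \in _); rewrite ?mulr1 ?mulr0.
  by rewrite !H WX.
suff [] : Q G by [].
exact: (@bounded_measurable_ind R _ (g_sigma_algebra_preimageType Z)
  Q Qclosed QA G K).
Qed.

End bounded_integrals.

(** * Density of the continuous functions of Z *)

Section density.
Context (R : realType) (d : measure_display) (T : measurableType d).
Context (P : probability T R).
Implicit Types (f g U F Z : T -> R) (K L M eps : R).

(** The weight U makes it possible to control a product with an unbounded
    integrable function by the same approximation. *)
Definition approximable U Z f : Prop :=
  [/\ measurable_fun setT f, exists L : R, (forall x, `|f x| <= L)%R &
  forall e : R, (0 < e)%R -> exists g : R -> R, [/\ continuous g,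
    exists L : R, (forall z, `|g z| <= L)%R &
    (\int[P]_x (U x * `|f x - g (Z x)|) <= e)%R]].

Context (U Z : T -> R).
Context (mZ : measurable_fun setT Z).
Context (iU : P.-integrable setT (EFin \o U)).
Context (U0 : forall x, (0 <= U x)%R).

Lemma integrable_weighted_dist f g (L M : R) :
  measurable_fun setT f -> measurable_fun setT g ->
  (forall x, `|f x| <= L)%R -> (forall x, `|g x| <= M)%R ->
  P.-integrable setT (EFin \o (fun x => U x * `|f x - g x|)%R).
Proof.
move=> mf mg fL gM.
apply: (@integrable_mul_bounded _ _ _ P U (fun x => `|f x - g x|)%R (L + M)%R) => //.
  by apply: measurableT_comp => //; exact: measurable_funB.
by move=> x; rewrite normr_id (le_trans (ler_normB _ _))// lerD.
Qed.

Lemma approximable_closed : bounded_limit_closed (approximable U Z).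
Proof.
split.
- move=> a f1 f2 [mf1 [L1 f1L] Q1] [mf2 [L2 f2L] Q2]; split.
  + by apply: measurable_funD => //; exact: measurable_funM.
  + exists (`|a| * L1 + L2)%R => x; rewrite (le_trans (ler_normD _ _))//.
    by rewrite lerD// normrM ler_wpM2l.
  + move=> e e0.
    have a1 : (0 < `|a| + 1)%R by rewrite ltr_wpDl.
    have e20 : (0 < e / 2)%R by rewrite divr_gt0.
    have [g1 [cg1 [M1 g1M] g1e]] := Q1 (e / 2 / (`|a| + 1))%R
      (divr_gt0 e20 a1).
    have [g2 [cg2 [M2 g2M] g2e]] := Q2 _ e20.
    exists (fun z => a * g1 z + g2 z)%R.
    have cg : continuous (fun z => a * g1 z + g2 z)%R.
      move=> z; apply: cvgD; last exact: cg2.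
      by apply: cvgM; [exact: cvg_cst|exact: cg1].
    have gL z : (`|a * g1 z + g2 z| <= `|a| * M1 + M2)%R.
      by rewrite (le_trans (ler_normD _ _))// lerD// normrM ler_wpM2l.
    split => //; first by exists (`|a| * M1 + M2)%R.
    have i1 := integrable_weighted_dist mf1
      (measurable_continuous_comp cg1 mZ) f1L (fun x => g1M (Z x)).
    have i2 := integrable_weighted_dist mf2
      (measurable_continuous_comp cg2 mZ) f2L (fun x => g2M (Z x)).
    have i1a := @integrableZl _ _ _ _ _ measurableT `|a|%R _ i1.
    apply: (@le_trans _ _ (\int[P]_x (`|a| * (U x * `|f1 x - g1 (Z x)|) +
        U x * `|f2 x - g2 (Z x)|))%R).
      apply: le_Rintegral => //.
      * apply: (@integrable_weighted_dist _ _
          (`|a| * L1 + L2)%R (`|a| * M1 + M2)%R) => //.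
        - by apply: measurable_funD => //; exact: measurable_funM.
        - exact: (measurable_continuous_comp cg mZ).
        - move=> x; rewrite (le_trans (ler_normD _ _))//.
          by rewrite lerD// normrM ler_wpM2l.
      * exact: (@integrableD _ _ _ _ _ measurableT _ _ i1a i2).
      * move=> x _.
        rewrite mulrCA -mulrDr ler_wpM2l// -normrM (le_trans _ (ler_normD _ _))//.
        by rewrite le_eqVlt; apply/orP; left; apply/eqP; congr (`|_|)%R; ring.
    rewrite RintegralD// RintegralZl//.
    have := ler_wpM2l (normr_ge0 a) g1e.
    have : (`|a| * (e / 2 / (`|a| + 1)) <= e / 2)%R.
      rewrite mulrA ler_pdivrMr// mulrC ler_wpM2l//; last by rewrite lerDl.
      by rewrite divr_ge0// ltW.
    lra.
- move=> f_ f M Qf fM ff.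
  have mf n : measurable_fun setT (f_ n) by case: (Qf n).
  have mlim : measurable_fun setT f.
    by apply: measurable_fun_cvg mf _ => x _; exact: ff.
  have flim x : (`|f x| <= M)%R by exact: normr_lim_le (ff x) _.
  split => //; first by exists M.
  move=> e e0; have e20 : (0 < e / 2)%R by exact: divr_gt0.
  have : (\int[P]_x (U x * `|f_ n x - f x|) @[n --> \oo] -->
          \int[P]_x (U x * 0))%R.
    apply: (@cvg_integral_bounded _ _ _ P U _ _ (M + M)%R) => //.
    + by move=> n; apply: measurableT_comp => //; exact: measurable_funB.
    + by move=> n x; rewrite normr_id (le_trans (ler_normB _ _))// lerD.
    + move=> x; rewrite -[X in _ --> X](normr0 R) -(subrr (f x)).
      apply: cvg_norm; apply: cvgB; [exact: ff|exact: cvg_cst].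
  under eq_Rintegral do rewrite mulr0.
  rewrite Rintegral_cst// mul0r => /cvgrPdist_le /(_ _ e20) [n _ /(_ n (leqnn n))].
  rewrite sub0r normrN => fne.
  have [_ _ /(_ _ e20)[g [cg [L gL] ge]]] := Qf n.
  exists g; split => //; first by exists L.
  have i1 := integrable_weighted_dist (mf n) mlim (fM n) flim.
  have mgZ := measurable_continuous_comp cg mZ.
  have i2 := integrable_weighted_dist (mf n) mgZ (fM n) (fun x => gL (Z x)).
  apply: (@le_trans _ _ (\int[P]_x (U x * `|f_ n x - f x| +
      U x * `|f_ n x - g (Z x)|))%R).
    apply: le_Rintegral => //.
    + exact: (integrable_weighted_dist mlim mgZ flim (fun x => gL (Z x))).
    + exact: (@integrableD _ _ _ _ _ measurableT _ _ i1 i2).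
    + move=> x _; rewrite -mulrDr ler_wpM2l//.
      by rewrite (distrC (f_ n x) (f x)) ler_distD.
  rewrite RintegralD//.
  have := ler_norm (\int[P]_x (U x * `|f_ n x - f x|))%R; lra.
Qed.

Lemma continuous_dense F K eps :
  measurable_fun [set: g_sigma_algebra_preimageType Z]
    (F : g_sigma_algebra_preimageType Z -> R) ->
  (forall x, `|F x| <= K)%R -> (0 < eps)%R ->
  exists g : R -> R, [/\ continuous g, (forall z, `|g z| <= K)%R &
    (\int[P]_x (U x * `|F x - g (Z x)|) <= eps)%R].
Proof.
move=> mF FK eps0.
have QC (g : R -> R) L : continuous g -> (forall z, `|g z| <= L)%R ->
    approximable U Z (g \o Z).
  move=> cg gL; split; first exact: measurable_continuous_comp.
    by exists L => x; exact: gL.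
  move=> e e0; exists g; split => //; first by exists L.
  under eq_Rintegral do rewrite subrr normr0 mulr0.
  by rewrite Rintegral_cst// mul0r ltW.
have [_ _ /(_ _ eps0) [g [cg [L gL] ge]]] :=
  sigma_fun_ind approximable_closed QC mF FK.
have K0 : (0 <= K)%R := le_trans (normr_ge0 _) (FK point).
have mFT := sigma_measurable_fun mZ mF.
(* truncating g at the bound K of F does not increase the distance to F *)
have cclip : continuous (clip K \o g).
  by move=> z; apply: continuous_comp; [exact: cg|exact: continuous_clip].
exists (clip K \o g); split => //; first by move=> z; exact: normr_clip_le.
apply: le_trans ge; apply: le_Rintegral => //.
- apply: (@integrable_weighted_dist _ _ K K) => //.
    exact: measurable_continuous_comp.
  by move=> x; exact: normr_clip_le.
- have mgZ := measurable_continuous_comp cg mZ.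
  exact: (integrable_weighted_dist mFT mgZ FK (fun x => gL (Z x))).
- move=> x _; rewrite ler_wpM2l//=.
  by rewrite -{1}(clip_id (FK x)) dist_clip_le.
Qed.

End density.

(** * Variance and second moment *)

Section second_moment.
Context (R : realType) (d : measure_display) (T : measurableType d).
Context (P : probability T R).
Implicit Types (f g W X Z : T -> R) (K B C : R).

Lemma measurable_clip f K : measurable_fun setT f ->
  measurable_fun setT (fun x => clip K (f x)).
Proof.
by move=> mf; apply: (measurableT_comp _ mf); apply: continuous_measurable_fun;
  exact: continuous_clip.
Qed.

(** The squared truncations increase to the square of f, so by monotone
    convergence a uniform bound on them both proves square integrability and
    bounds the second moment. *)
Lemma integral_sqr_clip_le f (L : \bar R) : measurable_fun setT f ->
  (forall k : nat, \int[P]_x ((clip k%:R (f x) ^+ 2)%R%:E) <= L) ->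
  \int[P]_x ((f x ^+ 2)%R%:E) <= L.
Proof.
move=> mf fL.
pose h (k : nat) x : \bar R := (clip k%:R (f x) ^+ 2)%R%:E.
have mh k : measurable_fun setT (h k).
  by apply/measurable_EFinP/measurable_funX/measurable_clip.
have h0 k x : setT x -> 0 <= h k x by move=> _; rewrite lee_fin sqr_ge0.
have ndh x : setT x -> nondecreasing_seq (h ^~ x).
  by move=> _ m n mn; rewrite lee_fin clip_sqr_mono// ler_nat.
have -> : \int[P]_x ((f x ^+ 2)%R%:E) = \int[P]_x limn (h ^~ x).
  apply: eq_integral => x _; apply/esym/cvg_lim => //.
  apply: cvg_near_cst; near=> k.
  by rewrite /h clip_id//; near: k; exact: nbhs_infty_ger.
rewrite monotone_convergence//; apply: lime_le; last by apply: nearW => k; exact: fL.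
apply: ereal_nondecreasing_is_cvgn => m n mn.
by apply: ge0_le_integral => //; [exact: h0|move=> x /ndh; exact].
Unshelve. all: by end_near. Qed.

Lemma varianceE_int W :
  'V_P[W] = \int[P]_x (((W x - fine 'E_P[W]) ^+ 2)%R%:E).
Proof.
rewrite /variance !unlock; apply: eq_integral => x _.
by rewrite expr2.
Qed.

(** When the variance is finite, the difference of both sides is E[(V - g)^2],
    where V = W - E[W]. *)
Lemma variance_ge W g K : P.-integrable setT (EFin \o W) ->
  measurable_fun setT g -> (forall x, `|g x| <= K)%R ->
  (2 * \int[P]_x ((W x - fine 'E_P[W]) * g x) - \int[P]_x (g x ^+ 2))%R%:E
    <= 'V_P[W].
Proof.
move=> iW mg gK; rewrite varianceE_int; set m := fine _.
have mW : measurable_fun setT W by apply/measurable_EFinP/(measurable_int P).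
(* an infinite variance bounds anything; a finite one makes V square integrable *)
have [|] := ltP (\int[P]_x (((W x - m) ^+ 2)%R%:E)) +oo; last first.
  by rewrite leye_eq => /eqP ->; rewrite leey.
move=> Voo.
have iV2 : P.-integrable setT (EFin \o (fun x => (W x - m) ^+ 2)%R).
  apply/integrableP; split.
    by apply/measurable_EFinP/measurable_funX/measurable_funB.
  under eq_integral => x _ do rewrite /= ger0_norm ?sqr_ge0//.
  exact: Voo.
have iV : P.-integrable setT (EFin \o (fun x => W x - m)%R).
  apply: (@integrableB _ _ _ P setT measurableT (EFin \o W) (EFin \o cst m)) => //.
  exact: (@integrable_bounded _ _ _ P (cst m) `|m|%R).
have iVg := integrable_mul_bounded iV mg gK.
have ig2 := integrable_bounded_sqr P mg gK.
have i2Vg := @integrableZl _ _ _ _ _ measurableT 2%R _ iVg.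
rewrite -RintegralZl// -RintegralB// -[leRHS]fineK; last exact: integrable_fin_num.
rewrite lee_fin; apply: le_Rintegral => //.
  exact: (@integrableB _ _ _ P setT measurableT _ _ i2Vg ig2).
move=> x _; have := sqr_ge0 (W x - m - g x)%R; nra.
Qed.

Lemma integrable_sqr_fin X C : measurable_fun setT X ->
  \int[P]_x ((X x ^+ 2)%R%:E) <= C%:E ->
  P.-integrable setT (EFin \o (fun x => X x ^+ 2)%R).
Proof.
move=> mX XC; apply/integrableP; split.
  by apply/measurable_EFinP/measurable_funX.
under eq_integral => x _ do rewrite /= ger0_norm ?sqr_ge0//.
exact: le_lt_trans XC (ltry C).
Qed.

Lemma integrable_of_sqr X C : measurable_fun setT X ->
  \int[P]_x ((X x ^+ 2)%R%:E) <= C%:E -> P.-integrable setT (EFin \o X).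
Proof.
move=> mX XC; have iX2 := integrable_sqr_fin mX XC.
have i1 : P.-integrable setT (EFin \o cst 1%R).
  exact: (@integrable_bounded _ _ _ P (cst 1%R) `|1|%R).
apply: (@le_integrable _ _ _ P setT measurableT _
  (EFin \o (fun x => X x ^+ 2 + 1)%R)).
- exact/measurable_EFinP.
- move=> x _; rewrite lee_fin [leRHS]ger0_norm; last first.
    by rewrite addr_ge0// sqr_ge0.
  by rewrite ler_norml; apply/andP; split; nra.
- exact: (@integrableD _ _ _ P setT measurableT _ _ iX2 i1).
Qed.

(** The bound is uniform over all X with second moment at most C: it replaces
    uniform integrability in the passage to the limit. *)
Lemma truncation_error X g B C K : measurable_fun setT X ->
  \int[P]_x ((X x ^+ 2)%R%:E) <= C%:E -> measurable_fun setT g ->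
  (forall x, `|g x| <= B)%R -> (0 < K)%R ->
  (`|\int[P]_x (X x * g x) - \int[P]_x (clip K (X x) * g x)| <= B * C / K)%R.
Proof.
move=> mX XC mg gB K0.
have B0 : (0 <= B)%R := le_trans (normr_ge0 _) (gB point).
have iX2 := integrable_sqr_fin mX XC.
have iX := integrable_of_sqr mX XC.
have mc := measurable_clip K mX.
have ic : P.-integrable setT (EFin \o (fun x => clip K (X x))).
  by apply: (@integrable_bounded _ _ _ P _ K) => // x; exact/normr_clip_le/ltW.
have iXg := integrable_mul_bounded iX mg gB.
have icg := integrable_mul_bounded ic mg gB.
have iD := @integrableB _ _ _ P setT measurableT _ _ iXg icg.
have iBK := @integrableZl _ _ _ _ _ measurableT (B / K)%R _ iX2.
rewrite -RintegralB//.
apply: le_trans (le_normr_Rintegral measurableT iD) _.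
apply: (@le_trans _ _ (\int[P]_x (B / K * X x ^+ 2))%R).
  apply: le_Rintegral => //; first exact: integrable_norm iD.
  move=> x _; rewrite -mulrBl normrM mulrAC ler_pdivlMr// mulrAC.
  by rewrite [leRHS]mulrC ler_pM ?mulr_ge0// ?dist_clip_tail// ltW.
rewrite RintegralZl// [leRHS]mulrAC ler_wpM2l//.
  by rewrite divr_ge0// ltW.
by rewrite -lee_fin /Rintegral fineK// integrable_fin_num.
Qed.

End second_moment.

(** On the right-hand side the conditional expectation is gone: only the law of
    (X, Z) is left. *)
Lemma cond_expectation_centered (R : realType) (d : measure_display)
    (T : measurableType d) (P : probability T R) (X Z W : T -> R)
    (g : R -> R) (K : R) :
  measurable_fun setT Z -> P.-integrable setT (EFin \o X) ->
  is_cond_expectation P X Z W -> continuous g -> (forall z, `|g z| <= K)%R ->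
  (\int[P]_w ((W w - fine 'E_P[W]) * g (Z w)) =
   \int[P]_w (X w * g (Z w)) - \int[P]_w X w * \int[P]_w g (Z w))%R.
Proof.
move=> mZ iX hW cg gK; have [mW iW WX] := hW.
have mgZ : measurable_fun setT (fun w => g (Z w)).
  exact: measurable_continuous_comp.
have mG : measurable_fun [set: g_sigma_algebra_preimageType Z]
    ((fun w => g (Z w)) : g_sigma_algebra_preimageType Z -> R).
  apply: (measurableT_comp (continuous_measurable_fun cg)).
  by move=> _ B mB; exists B.
have gZK w : (`|g (Z w)| <= K)%R by [].
have iWg := integrable_mul_bounded iW mgZ gZK.
have ig : P.-integrable setT (EFin \o (fun w => g (Z w))).
  exact: (integrable_bounded P mgZ gZK).
have EWX : fine 'E_P[W] = (\int[P]_w X w)%R.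
  by rewrite unlock /Rintegral WX//; exists setT => //; rewrite setTI.
rewrite EWX; set m := (\int[P]_w X w)%R.
have imgZ := @integrableZl _ _ _ _ _ measurableT m _ ig.
under eq_Rintegral do rewrite mulrBl.
by rewrite RintegralB// RintegralZl// (cond_expectation_bounded mZ iX hW mG gZK).
Qed.

(** * Passage to the weak limit *)

Lemma cvg_le_limn_einf (R : realType) (r : nat -> R) (V : nat -> \bar R) (l : R) :
  r n @[n --> \oo] --> l -> (forall n, (r n)%:E <= V n) ->
  l%:E <= limn_einf V.
Proof.
move=> rl rV; have Erl : (r n)%:E @[n --> \oo] --> l%:E.
  by apply: cvg_EFin; [exact: nearW|exact: rl].
rewrite -(cvg_limn_einf_sup Erl).1 !limn_einf_lim.
apply: lee_lim; [exact: is_cvg_einfs|exact: is_cvg_einfs|apply: nearW => n].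
apply: le_ereal_inf_tmp => _ [k /= nk <-].
by apply: le_trans (rV k); apply: ereal_inf_lbound; exists k.
Qed.

Section weak_limit.
Context (R : realType) (dn : nat -> measure_display)
  (Tn : forall n : nat, measurableType (dn n))
  (Pn : forall n : nat, probability (Tn n) R)
  (Xn Yn : forall n : nat, {RV (Pn n) >-> R})
  (d : measure_display) (T : measurableType d) (P : probability T R)
  (X Y : {RV P >-> R}).
Context (hcvg : cvg_in_distribution2 Pn (fun n w => (Xn n w, Yn n w))
              P (fun w => (X w, Y w))).

Lemma cvg_Rintegral (f : R * R -> R) (B : R) : continuous f ->
  (forall v, `|f v| <= B)%R ->
  measurable_fun setT (fun w => f (X w, Y w)) ->
  (\int[Pn n]_w f (Xn n w, Yn n w) @[n --> \oo] --> \int[P]_w f (X w, Y w))%R.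
Proof.
move=> cf fB mf; have bf : bounded_fun f.
  exists B; split; first exact: num_real.
  by move=> M BM v _; exact: le_trans (fB v) (ltW BM).
have := hcvg cf bf; rewrite unlock => H.
apply: fine_cvg; rewrite fineK//.
apply: integrable_fin_num => //.
exact: (@integrable_bounded _ _ _ P _ B).
Qed.

Context (C : R).
Context (XnC : forall n, \int[Pn n]_w ((Xn n w ^+ 2)%R%:E) <= C%:E).

(** Fatou's lemma for convergence in distribution: the truncated squares are
    bounded and continuous, so their integrals converge. *)
Lemma limit_sqr_le : \int[P]_w ((X w ^+ 2)%R%:E) <= C%:E.
Proof.
apply: integral_sqr_clip_le => // k.
have mc : measurable_fun setT (fun w => clip k%:R (X w) ^+ 2)%R.
  exact/measurable_funX/measurable_clip.
have bc (x : R) : (`|clip k%:R x ^+ 2| <= k%:R ^+ 2)%R.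
  by rewrite normrX lerXn2r ?nnegrE// normr_clip_le.
have ic : P.-integrable setT (EFin \o (fun w => clip k%:R (X w) ^+ 2)%R).
  exact: (@integrable_bounded _ _ _ P _ (k%:R ^+ 2)%R).
rewrite -[leLHS]fineK; last exact: integrable_fin_num.
rewrite lee_fin.
have cl := @cvg_Rintegral (fun v => clip k%:R v.1 ^+ 2)%R (k%:R ^+ 2)%R.
have {}cl := cl _ (fun v => bc v.1) mc.
have cc : continuous (fun v : R * R => clip k%:R v.1 ^+ 2)%R.
  move=> v; apply: (@continuous_comp _ _ _ (fun v : R * R => clip k%:R v.1)
    (fun x => x ^+ 2)%R); last exact: exprn_continuous.
  apply: (@continuous_comp _ _ _ fst (clip k%:R)); first exact: cvg_fst.
  exact: continuous_clip.
have {}cl := cl cc.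
rewrite -[leLHS](cvg_lim (@Rhausdorff R) cl).
apply: limr_le; first by apply/cvg_ex; eexists; exact: cl.
apply: nearW => n; rewrite -lee_fin.
have mcn : measurable_fun setT (fun w => clip k%:R (Xn n w) ^+ 2)%R.
  exact/measurable_funX/measurable_clip.
rewrite /Rintegral fineK; last first.
  apply: integrable_fin_num => //.
  exact: (@integrable_bounded _ _ _ (Pn n) _ (k%:R ^+ 2)%R).
apply: le_trans (XnC n); apply: ge0_le_integral => //.
- by move=> w _; rewrite lee_fin sqr_ge0.
- exact/measurable_EFinP.
- exact/measurable_EFinP/measurable_funX.
- by move=> w _; rewrite lee_fin sqr_clip_le.
Qed.

(** The integrand x g(x + y) is unbounded; it is compared with its truncation
    in x, once for each n and once for the limit. *)
Lemma cvg_Rintegral_mul (g : R -> R) (B : R) : continuous g ->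
  (forall z, `|g z| <= B)%R ->
  (\int[Pn n]_w (Xn n w * g (Xn n w + Yn n w)) @[n --> \oo] -->
   \int[P]_w (X w * g (X w + Y w)))%R.
Proof.
move=> cg gB.
have B0 : (0 <= B)%R := le_trans (normr_ge0 _) (gB 0%R).
have C0 : (0 <= C)%R.
  rewrite -lee_fin; apply: le_trans limit_sqr_le; apply: integral_ge0 => w _.
  by rewrite lee_fin sqr_ge0.
have mg : measurable_fun setT (fun w => g (X w + Y w)%R).
  by apply: (measurable_continuous_comp cg); exact: measurable_funD.
have mgn n : measurable_fun setT (fun w => g (Xn n w + Yn n w)%R).
  by apply: (measurable_continuous_comp cg); exact: measurable_funD.
apply/cvgrPdist_le => e e0.
(* K makes each of the two truncation errors at most e / 3 *)
pose K := (3 * (B * C) / e + 1)%R.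
have K0 : (0 < K)%R.
  by rewrite ltr_wpDl// divr_ge0 ?mulr_ge0// ltW.
have BCK : (B * C / K <= e / 3)%R.
  have -> : (K = (B * C + e / 3) / (e / 3))%R by rewrite /K; field; rewrite gt_eqF.
  rewrite ler_pdivrMr ?divr_gt0 ?ltr_wpDl ?mulr_ge0 ?divr_gt0//.
  rewrite mulrCA mulfV ?mulr1; last by rewrite gt_eqF// divr_gt0.
  by rewrite lerDl divr_ge0// ltW.
have cc : continuous (fun v : R * R => clip K v.1 * g (v.1 + v.2))%R.
  move=> v; apply: cvgM.
    apply: (@continuous_comp _ _ _ fst (clip K)); first exact: cvg_fst.
    exact: continuous_clip.
  apply: (@continuous_comp _ _ _ (fun v : R * R => v.1 + v.2)%R g); last exact: cg.
  by apply: cvgD; [exact: cvg_fst|exact: cvg_snd].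
have bc (v : R * R) : (`|clip K v.1 * g (v.1 + v.2)| <= K * B)%R.
  by rewrite normrM ler_pM// normr_clip_le// ltW.
have mc : measurable_fun setT (fun w => clip K (X w) * g (X w + Y w))%R.
  by apply: measurable_funM => //; exact: measurable_clip.
have /cvgrPdist_le/(_ (e / 3)%R) := cvg_Rintegral cc bc mc.
move=> /(_ (divr_gt0 e0 _)) []; first by [].
move=> N _ NP; exists N => // n /NP /= h.
have mX : measurable_fun setT X by [].
have mXn : measurable_fun setT (Xn n) by [].
have h1 := truncation_error mX limit_sqr_le mg (fun w => gB (X w + Y w)%R) K0.
have h2 := truncation_error mXn (XnC n) (mgn n) (fun w => gB (Xn n w + Yn n w)%R) K0.
move: h h1 h2; rewrite !ler_norml; lra.
Qed.

Lemma variational_le_limn_einf (Wn : forall n : nat, Tn n -> R) (W : T -> R)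
    (g : R -> R) (K : R) :
  (forall n : nat,
     is_cond_expectation (Pn n) (Xn n) (fun w => (Xn n w + Yn n w)%R) (Wn n)) ->
  is_cond_expectation P X (fun w => (X w + Y w)%R) W ->
  continuous g -> (forall z, `|g z| <= K)%R ->
  (2 * \int[P]_w ((W w - fine 'E_P[W]) * g (X w + Y w)) -
     \int[P]_w (g (X w + Y w) ^+ 2))%R%:E
    <= limn_einf (fun n : nat => 'V_(Pn n)[Wn n]).
Proof.
move=> hWn hW cg gK.
have XC := limit_sqr_le.
have mX : measurable_fun setT X by [].
have mXn n : measurable_fun setT (Xn n) by [].
have iX := integrable_of_sqr mX XC.
have iXn n := integrable_of_sqr (mXn n) (XnC n).
pose Z w := (X w + Y w)%R; pose Zn n w := (Xn n w + Yn n w)%R.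
have mZ : measurable_fun setT Z by exact: measurable_funD.
have mZn n : measurable_fun setT (Zn n) by exact: measurable_funD.
apply: (@cvg_le_limn_einf _ (fun n =>
  2 * \int[Pn n]_w ((Wn n w - fine 'E_(Pn n)[Wn n]) * g (Zn n w)) -
    \int[Pn n]_w (g (Zn n w) ^+ 2))%R); last first.
  move=> n; have [_ iWn _] := hWn n.
  apply: (variance_ge iWn) => //.
  exact: (measurable_continuous_comp cg (mZn n)).
have cone : continuous (cst 1%R : R -> R) by move=> z; exact: cvg_cst.
have one1 (z : R) : (`|cst 1 z : R| <= 1)%R by rewrite normr1.
(* the case g = 1 is the convergence of the means *)
have cm := cvg_Rintegral_mul cone one1.
have cXg := cvg_Rintegral_mul cg gK.
have cgD : continuous (fun v : R * R => g (v.1 + v.2)%R).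
  move=> v; apply: (@continuous_comp _ _ _ (fun v : R * R => v.1 + v.2)%R g);
    last exact: cg.
  by apply: cvgD; [exact: cvg_fst|exact: cvg_snd].
have mgZ : measurable_fun setT (fun w => g (Z w)).
  exact: measurable_continuous_comp.
have c1 := cvg_Rintegral cgD (fun v => gK _) mgZ.
have cg2 : continuous (fun v : R * R => g (v.1 + v.2) ^+ 2)%R.
  move=> v; apply: (@continuous_comp _ _ _ (fun v : R * R => g (v.1 + v.2)%R)
    (fun x => x ^+ 2)%R); [exact: cgD|exact: exprn_continuous].
have g2K (v : R * R) : (`|g (v.1 + v.2) ^+ 2| <= K ^+ 2)%R.
  by rewrite normrX lerXn2r ?nnegrE// (le_trans _ (gK 0%R)).
have c2 := cvg_Rintegral cg2 g2K (measurable_funX 2 mgZ).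
rewrite (cond_expectation_centered mZ iX hW cg gK).
under eq_fun do rewrite (cond_expectation_centered (mZn _) (iXn _) (hWn _) cg gK).
apply: cvgB; last exact: c2.
apply: cvgM; first exact: cvg_cst.
apply: cvgB; first exact: cXg.
apply: cvgM; last exact: c1.
move: cm; under eq_Rintegral do rewrite mulr1.
by under [X in X @ _ --> _ -> _]eq_fun do under eq_Rintegral do rewrite mulr1.
Qed.

End weak_limit.

(** * Lower semicontinuity of the variance *)

Theorem theorem2 (R : realType)
    (dn : nat -> measure_display) (Tn : forall n : nat, measurableType (dn n))
    (Pn : forall n : nat, probability (Tn n) R)
    (Xn Yn : forall n : nat, {RV (Pn n) >-> R})
    (d : measure_display) (T : measurableType d) (P : probability T R)
    (X Y : {RV P >-> R})
    (hcvg : cvg_in_distribution2 Pn (fun n w => (Xn n w, Yn n w))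
              P (fun w => (X w, Y w)))
    (hsup : ereal_sup
              (range (fun n : nat => 'E_(Pn n)[fun w => (Xn n w ^+ 2)%R])) < +oo)
    (Wn : forall n : nat, Tn n -> R)
    (hWn : forall n : nat,
       is_cond_expectation (Pn n) (Xn n) (fun w => (Xn n w + Yn n w)%R) (Wn n))
    (W : T -> R)
    (hW : is_cond_expectation P X (fun w => (X w + Y w)%R) W) :
  'V_P[W] <= limn_einf (fun n : nat => 'V_(Pn n)[Wn n]).
Proof.
have [C XnC] : exists C : R, forall n, \int[Pn n]_w ((Xn n w ^+ 2)%R%:E) <= C%:E.
  set S := ereal_sup _ in hsup.
  have le_S n : \int[Pn n]_w ((Xn n w ^+ 2)%R%:E) <= S.
    by apply: ereal_sup_ubound; exists n => //; rewrite unlock.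
  have S0 : 0 <= S.
    apply: le_trans (le_S 0%N); apply: integral_ge0 => w _.
    by rewrite lee_fin sqr_ge0.
  by exists (fine S) => n; rewrite fineK// ge0_fin_numE.
pose Z w := (X w + Y w)%R.
have mZ : measurable_fun setT Z by exact: measurable_funD.
set L := limn_einf _; set m := fine 'E_P[W]; pose V w := (W w - m)%R.
have le_L (g : R -> R) K : continuous g -> (forall z, `|g z| <= K)%R ->
    (2 * \int[P]_w (V w * g (Z w)) - \int[P]_w (g (Z w) ^+ 2))%R%:E <= L.
  exact: (variational_le_limn_einf hcvg XnC hWn hW).
have [mW iW _] := hW.
have mWT := sigma_measurable_fun mZ mW.
have mV : measurable_fun setT V by exact: measurable_funB.
have iV : P.-integrable setT (EFin \o V).
  apply: (@integrableB _ _ _ P setT measurableT (EFin \o W) (EFin \o cst m)) => //.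
  exact: (@integrable_bounded _ _ _ P (cst m) `|m|%R).
rewrite varianceE_int -/m; apply: integral_sqr_clip_le => // k.
pose G w := clip k%:R (V w).
have GK w : (`|G w| <= k%:R)%R by exact: normr_clip_le.
have mG : measurable_fun setT G by exact: measurable_clip.
have msG : measurable_fun [set: g_sigma_algebra_preimageType Z]
    (G : g_sigma_algebra_preimageType Z -> R).
  apply: measurable_clip; exact: measurable_funB.
have iG2 := integrable_bounded_sqr P mG GK.
rewrite -/G -[leLHS]fineK; last exact: integrable_fin_num.
rewrite -[fine _]/(\int[P]_w (G w ^+ 2))%R.
apply/lee_addgt0Pr => e e0.
(* replacing G by g(Z) changes 2 V G by at most 2 |V| |G - g(Z)|, and G^2 by at
   most 2 k |G - g(Z)| *)
pose U w := (2 * `|V w| + 2 * k%:R)%R.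
have iU : P.-integrable setT (EFin \o U).
  apply: (@integrableD _ _ _ P setT measurableT (EFin \o (fun w => 2 * `|V w|)%R)
    (EFin \o cst (2 * k%:R)%R)) => //.
    exact: (@integrableZl _ _ _ _ _ measurableT 2%R _ (integrable_norm iV)).
  exact: (@integrable_bounded _ _ _ P (cst _) `|2 * k%:R|%R).
have U0 w : (0 <= U w)%R by rewrite addr_ge0// mulr_ge0.
have [g [cg gK Ug]] := continuous_dense mZ iU U0 msG GK e0.
have mgZ : measurable_fun setT (fun w => g (Z w)).
  exact: measurable_continuous_comp.
apply: le_trans (leeD2r e%:E (le_L g _ cg gK)); rewrite -EFinD lee_fin.
have iVg := integrable_mul_bounded iV mgZ (fun w => gK (Z w)).
have i2Vg := @integrableZl _ _ _ _ _ measurableT 2%R _ iVg.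
have ig2 := integrable_bounded_sqr P mgZ (fun w => gK (Z w)).
have iUg := integrable_weighted_dist iU mG mgZ GK (fun w => gK (Z w)).
have iR := @integrableB _ _ _ P setT measurableT _ _ i2Vg ig2.
apply: le_trans (lerD (lexx _) Ug).
rewrite -RintegralZl// -RintegralB// -RintegralD//.
apply: le_Rintegral => //.
  exact: (@integrableD _ _ _ P setT measurableT _ _ iR iUg).
move=> w _.
have VG : (G w ^+ 2 <= V w * G w)%R by exact: clip_sqr_le.
have H1 : (V w * (G w - g (Z w)) <= `|V w| * `|G w - g (Z w)|)%R.
  by rewrite -normrM ler_norm.
have H2 : ((g (Z w) + G w) * (g (Z w) - G w) <= (k%:R + k%:R) * `|G w - g (Z w)|)%R.
  rewrite distrC (le_trans (ler_norm _))// normrM ler_wpM2r//.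
  by rewrite (le_trans (ler_normD _ _))// lerD.
rewrite /U; lra.
Qed.
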